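(* Let $0<h,w\le 1$ be such that $hw\le 1/2$, and let $N\ge 1$ be an integer with $hw^3N\le 1/24$. Then whenever $X_1,\ldots,X_N$ are i.i.d. with law $\mu_{h,w}$, and $G$ is a standard Gaussian random variable, $$\mathrm{d}_{\mathrm{KS}}\left(\frac{X_1+\cdots+X_N}{\sqrt N},\,G\right)\ge\frac{1}{50}\,\frac{1}{\sqrt N}.$$
   Context: For real-valued random variables $Y,Z$, the Kolmogorov-Smirnov distance is $\mathrm{d}_{\mathrm{KS}}(Y,Z):=\sup_{s\in\mathbb{R}}|\mathbb{P}(Y\le s)-\mathbb{P}(Z\le s)|$. The probability law $\mu_{h,w}$ on $\mathbb{R}$ is defined by $$\mu_{h,w}(\mathrm{d}s)=(1-hw)\left(\frac{\delta_x(\mathrm{d}s)+\delta_{-x}(\mathrm{d}s)}{2}\right)+h\,\mathbf{1}_{[-w/2,w/2]}(s)\,\mathrm{d}s,$$ where $\delta_y$ is the Dirac mass at $y$ and $x=x_{h,w}=(1-hw^3/12)^{1/2}(1-hw)^{-1/2}$ is chosen so that $\int_{-\infty}^\infty s^2\mu_{h,w}(\mathrm{d}s)=1$. *)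

(* Defs.v *)
From HB Require Import structures.
From mathcomp Require Import all_boot all_order all_algebra.
From mathcomp Require Import all_classical all_reals all_analysis.
From mathcomp Require Import measurable_realfun.

Set Implicit Arguments.
Unset Strict Implicit.
Unset Printing Implicit Defensive.

Import Order.TTheory GRing.Theory Num.Theory.
Import numFieldNormedType.Exports.

Local Open Scope classical_set_scope.
Local Open Scope ring_scope.

(* Two laws need only agree on measurable sets: elsewhere the values of a
   pushforward or of an integral are meaningless. *)
Definition has_law (R : realType) (d : measure_display) (T : measurableType d)
    (P : probability T R) (X : {RV P >-> R}) (m : set R -> \bar R) : Prop :=
  forall A : set R, measurable A -> distribution P X A = m A.

Definition mutually_independent (R : realType) (d : measure_display)
    (T : measurableType d) (P : probability T R) (I : finType)
    (X : I -> {RV P >-> R}) : Prop :=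
  forall (J : {set I}) (A : I -> set R), (forall i, measurable (A i)) ->
    P (\bigcap_(i in [set` J]) (X i @^-1` A i)) =
    (\prod_(i in J) P (X i @^-1` A i))%E.

Definition dKS (R : realType) (d d' : measure_display)
    (T : measurableType d) (T' : measurableType d')
    (P : probability T R) (Q : probability T' R)
    (Y : {RV P >-> R}) (Z : {RV Q >-> R}) : R :=
  sup [set `|fine (cdf Y s) - fine (cdf Z s)| | s in [set: R]].

Arguments has_law {R d T} P X m.
Arguments mutually_independent {R d T} P {I} X.
Arguments dKS {R d d' T T'} P Q Y Z.

(* Chosen so that mu_ h w has second moment 1. *)
Definition x_ (R : realType) (h w : R) : R :=
  Num.sqrt (1 - h * w ^+ 3 / 12) / Num.sqrt (1 - h * w).

Definition mu_ (R : realType) (h w : R) (A : set R) : \bar R :=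
  ((1 - h * w)%:E * ((\d_(x_ h w) A + \d_(- x_ h w)%R A) * (2^-1)%:E)
   + \int[lebesgue_measure]_(s in A) (h * \1_`[- (w / 2), w / 2] s)%:E)%E.

Definition normalized_sum (R : realType) (d : measure_display)
    (T : measurableType d) (P : probability T R) (N : nat)
    (X : 'I_N -> {RV P >-> R}) (t : T) : R :=
  (\sum_(i < N) X i t) / Num.sqrt N%:R.

Fact measurable_normalized_sum (R : realType) (d : measure_display)
    (T : measurableType d) (P : probability T R) (N : nat)
    (X : 'I_N -> {RV P >-> R}) : measurable_fun [set: T] (normalized_sum X).
Proof.
apply: measurable_funM; last exact: measurable_cst.
by apply: measurable_sum => i; exact: measurable_funPT.
Qed.

HB.instance Definition _ (R : realType) (d : measure_display)
    (T : measurableType d) (P : probability T R) (N : nat)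
    (X : 'I_N -> {RV P >-> R}) :=
  isMeasurableFun.Build _ _ _ _ (normalized_sum X)
    (measurable_normalized_sum X).

(* Main.v *)
Require Import Defs.
From HB Require Import structures.
From mathcomp Require Import all_boot all_order all_algebra.
From mathcomp Require Import all_classical all_reals all_analysis.
From mathcomp Require Import measurable_realfun ring lra zify.

Set Implicit Arguments.
Unset Strict Implicit.
Unset Printing Implicit Defensive.

Import Order.TTheory GRing.Theory Num.Theory.
Import numFieldNormedType.Exports.

Local Open Scope classical_set_scope.
Local Open Scope ring_scope.

(** The law mu_{h,w} is a lattice law, carried by {x, -x}, perturbed by a
    small uniform part.  With D = [-w/2, w/2] and U_i = X_i 1_D(X_i), each
    X_i - U_i almost surely lies in {0, x, -x}, so X_1 + ... + X_N is a point
    of the lattice x Z plus the error U_1 + ... + U_N.  The U_i are independent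
    and centred with variance h w^3 / 12, so by the assumption on h w^3 N the
    error has variance at most 1/288, and Chebyshev's inequality bounds by
    1 / (18 x^2) the probability that it reaches x/4
    ([lattice_decomposition], [trunc_sum_tail]).

    Hence the normalized sum seldom visits the gaps, the half-open intervals
    from (z + 1/4) x / sqrt N to (z + 3/4) x / sqrt N with z an integer, and
    the bound 1 / (18 x^2) controls all the gaps together
    ([normalized_sum_gaps]).  A Gaussian, on the contrary, gives each gap
    contained in [-x, x] a mass of order 1 / sqrt N ([normal_prob_itv_ge]).
    On one interval the two laws differ by at most twice the
    Kolmogorov-Smirnov distance ([dKS_itv]).  Summing this over the 2m gaps
    with -m <= z < m, where m is the integer part of sqrt N, and dividing by
    4m, the Gaussian mass leaves x (3 - x^2) / 40 and the lattice error costs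
    at most 1 / (36 x^2), both in units of 1 / sqrt N; since 1 <= x <= sqrt 2,
    the difference is at least 1/50 ([gap_tradeoff_ge]).  Considering many gaps
    at once is what makes a local limit theorem for the lattice part
    unnecessary. *)

(** * Second moment of a sum of independent centred variables *)

Section independence.
Context (R : realType) (d : measure_display) (T : measurableType d)
  (P : probability T R).

Lemma bounded_integrable (Y : T -> R) (c : R) :
  measurable_fun setT Y -> (forall t, `|Y t| <= c) ->
  P.-integrable setT (EFin \o Y).
Proof.
move=> mY Yc; apply: measurable_bounded_integrable => //.
  exact: (le_lt_trans (probability_le1 P measurableT) (ltry 1)).
exists c; split; first exact: num_real.
by move=> M cM t _ /=; exact: le_trans (Yc t) (ltW cM).
Qed.

(** By uniqueness of the product measure the joint law of (X, Y) is the product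
    of the marginal laws, so Fubini's theorem lets the integral over Y, which
    vanishes, be taken first. *)
Lemma expectation_mul_indep (X Y : {RV P >-> R}) (f : R -> R) (c : R) :
  measurable_fun setT f -> (forall s, `|f s| <= c) ->
  (forall A B, measurable A -> measurable B ->
     P (X @^-1` A `&` Y @^-1` B) = P (X @^-1` A) * P (Y @^-1` B))%E ->
  ('E_P[f \o Y] = 0 -> 'E_P[fun t => (f (X t) * f (Y t))%R] = 0)%E.
Proof.
move=> mf fc ind EY.
have mX : measurable_fun setT X by exact: measurable_funPT.
have mY : measurable_fun setT Y by exact: measurable_funPT.
have mZ : measurable_fun setT (fun t => (X t, Y t)).
  exact: measurable_fun_pair.
pose Z : {RV P >-> (R * R)%type} := mfun_Sub (mem_set mZ).
pose F (z : R * R) := (f z.1 * f z.2)%:E.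
have mF' : measurable_fun setT (fun z : R * R => f z.1 * f z.2).
  by apply: measurable_funM; exact: measurableT_comp.
have mF : measurable_fun setT F by exact/measurable_EFinP.
have c0 : 0 <= c by exact: le_trans (fc 0).
have intF : P.-integrable setT (F \o Z).
  apply: (@bounded_integrable _ (c * c)).
    exact: (measurableT_comp mF' mZ).
  by move=> t; rewrite normrM ler_pM.
rewrite unlock -[LHS](@integral_distribution _ _ _ _ _ P Z F mF intF).
pose m := (distribution P X \x distribution P Y)%E.
rewrite (@eq_measure_integral _ _ _ _ m); last first.
  by move=> A mA _; apply/esym; exact: product_measure_unique.
rewrite -integral12_prod_meas1; last first.
  apply: measurable_bounded_integrable => //.
    rewrite /= -setXTT product_measure1E// lte_mul_pinfty//.
      by rewrite fin_num_measure.
    exact: (le_lt_trans (probability_le1 _ measurableT) (ltry 1)).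
  exists (c * c); split; first exact: num_real.
  move=> M cM z _ /=; apply: le_trans (ltW cM).
  by rewrite normrM ler_pM.
apply: integral0_eq => x _; rewrite /fubini_F/= /F/=.
under eq_integral do rewrite EFinM.
rewrite integralZl//.
  suff -> : (\int[distribution P Y]_y (f y)%:E = 0)%E by rewrite mule0.
  rewrite (@integral_distribution _ _ _ _ _ P Y (EFin \o f)).
  - by rewrite -EY unlock.
  - exact/measurable_EFinP.
  - by apply: (@bounded_integrable _ c) => //; exact: measurableT_comp.
apply: measurable_bounded_integrable => //.
  exact: (le_lt_trans (probability_le1 _ measurableT) (ltry 1)).
exists c; split; first exact: num_real.
by move=> M cM t _ /=; exact: le_trans (fc t) (ltW cM).
Qed.

(** In the expansion of the square the off-diagonal terms vanish by pairwise
    independence; boundedness of f supplies all the integrability. *)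
Lemma expectation_sqr_sum (I : finType) (X : I -> {RV P >-> R}) (f : R -> R)
    (c : R) (v : \bar R) :
  measurable_fun setT f -> (forall s, `|f s| <= c) ->
  mutually_independent P X ->
  (forall i, 'E_P[f \o X i] = 0)%E ->
  (forall i, 'E_P[fun t => (f (X i t) ^+ 2)%R] = v)%E ->
  ('E_P[fun t => ((\sum_i f (X i t)) ^+ 2)%R] = \sum_(i : I) v)%E.
Proof.
move=> mf fc ind E1 E2.
have mfX i : measurable_fun setT (f \o X i).
  by apply: measurableT_comp => //; exact: measurable_funPT.
have c0 : 0 <= c by exact: le_trans (fc 0).
have int i j : P.-integrable setT (fun t => (f (X i t) * f (X j t))%:E).
  apply: (@bounded_integrable _ (c * c)).
    by apply: measurable_funM; exact: mfX.
  by move=> t; rewrite normrM ler_pM.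
transitivity (\int[P]_t \sum_i \sum_j (f (X i t) * f (X j t))%:E)%E.
  rewrite unlock; apply: eq_integral => t _.
  rewrite expr2 big_distrlr/= -sumEFin; apply: eq_bigr => i _.
  by rewrite -sumEFin.
rewrite integral_sum//; last by move=> i; exact: integrable_sum.
apply: eq_bigr => i _.
rewrite integral_sum// (bigD1 i)//= big1 ?adde0.
  by rewrite -(E2 i) unlock.
move=> j ji.
rewrite -[RHS](@expectation_mul_indep (X i) (X j) f c)//; first by rewrite unlock.
move=> A B mA mB.
(* The constraint A on coordinate i and B on coordinate j. *)
have := ind [set i; j]%SET (fun k => if k == i then A else B).
rewrite big_setU1/= ?inE 1?eq_sym// big_set1 eqxx (negPf ji) => <-.
  congr (P _); apply/seteqP; split => [t [At Bt] k|t h].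
    by rewrite /= !inE => /orP[]/eqP->; rewrite ?eqxx ?(negPf ji).
  split.
    by have := h i; rewrite /= !inE eqxx; apply.
  by have := h j; rewrite /= !inE eqxx orbT (negPf ji); apply.
by move=> k; case: ifP.
Qed.
End independence.
(** * The step law *)

Section step_law.
Context (R : realType).
Implicit Types h w : R.

Definition trunc w (s : R) : R := s * \1_`[- (w / 2), w / 2] s.

Lemma measurable_trunc w : measurable_fun setT (trunc w).
Proof. by apply: measurable_funM => //; exact: measurable_indic. Qed.

Lemma trunc_out w s : ~ `[- (w / 2), w / 2]%classic s -> trunc w s = 0.
Proof. by move=> sD; rewrite /trunc indicE memNset// mulr0. Qed.

Lemma trunc_in w s : `[- (w / 2), w / 2]%classic s -> trunc w s = s.
Proof. by move=> sD; rewrite /trunc indicE mem_set// mulr1. Qed.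

Lemma trunc_bounded w s : 0 <= w -> `|trunc w s| <= w.
Proof.
move=> w0; have [sD|sD] := pselect (`[- (w / 2), w / 2]%classic s).
  rewrite trunc_in//; move: sD; rewrite /= in_itv/= ler_norml; lra.
by rewrite trunc_out// normr0.
Qed.

Lemma x_ge1 h w : 0 < h -> 0 < w -> w <= 1 -> h * w <= 1 / 2 -> 1 <= x_ h w.
Proof.
move=> h0 w0 w1 hw.
have hw0 : 0 < h * w by rewrite mulr_gt0.
have hw3 : h * w ^+ 3 <= h * w.
  by rewrite ler_pM2l// exprS ler_piMr ?exprn_ile1// ltW.
rewrite /x_ ler_pdivlMr ?sqrtr_gt0; last lra.
by rewrite mul1r ler_sqrt; lra.
Qed.

Lemma x_sqr_le2 h w : 0 < h -> 0 < w -> h * w <= 1 / 2 -> x_ h w ^+ 2 <= 2.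
Proof.
move=> h0 w0 hw.
have hw0 : 0 < h * w by rewrite mulr_gt0.
have hw3 : 0 < h * w ^+ 3 by rewrite mulr_gt0// exprn_gt0.
rewrite /x_ exprMn exprVn (sqr_sqrtr (a := 1 - h * w)); last lra.
rewrite ler_pdivrMr; last lra.
have [h3|h3] := leP 0 (1 - h * w ^+ 3 / 12); first by rewrite sqr_sqrtr; lra.
by rewrite ler0_sqrtr ?expr0n/=; lra.
Qed.

(** The atoms lie outside the interval, since x >= 1 > w/2; only the uniform
    part remains. *)
Lemma mu_core h w A : 0 < h -> w <= 1 -> 1 <= x_ h w -> measurable A ->
  A `<=` `[- (w / 2), w / 2] -> (mu_ h w A = h%:E * lebesgue_measure A)%E.
Proof.
move=> h0 w1 x1 mA AD.
have nx : ~ A (x_ h w) by move/AD; rewrite /= in_itv/=; lra.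
have nNx : ~ A (- x_ h w) by move/AD; rewrite /= in_itv/=; lra.
rewrite /mu_ !diracE !memNset//= adde0 mul0e mule0 add0e.
rewrite (eq_integral (cst h%:E)); last first.
  by move=> t; rewrite inE => /AD tD; rewrite indicE mem_set// mulr1.
by rewrite integral_cst.
Qed.

Lemma mu_support h w : 
  mu_ h w (~` (`[- (w / 2), w / 2] `|` [set x_ h w; - x_ h w])) = 0.
Proof.
rewrite /mu_ !diracE memNset ?memNset; last 2 first.
  by move=> /not_orP[_]; apply; right.
  by move=> /not_orP[_]; apply; left.
rewrite /= adde0 mul0e mule0 add0e.
apply: integral0_eq => t /not_orP[tD _].
by rewrite indicE memNset// mulr0.
Qed.

Lemma integral_exprn (n : nat) (a b : R) : a < b ->
  (\int[lebesgue_measure]_(s in `[a, b]) (s ^+ n)%:E =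
   ((b ^+ n.+1 - a ^+ n.+1) / n.+1%:R)%:E)%E.
Proof.
move=> ab; pose F (s : R) : R := s ^+ n.+1 / n.+1%:R.
have dF (s : R) : is_derive s (1 : R) F (s ^+ n).
  have -> : F = n.+1%:R^-1 \*: (@GRing.exp R ^~ n.+1).
    by apply/funext => t; rewrite /F mulrC.
  have dX : is_derive s (1 : R) (@GRing.exp R ^~ n.+1) (n.+1%:R * s ^+ n).
    apply: DeriveDef; first exact: exprn_derivable.
    by rewrite exp_derive [LHS]mulr1.
  by apply: is_derive_eq; rewrite [LHS]mulKf.
have cF : continuous F.
  by move=> y; apply/differentiable_continuous/derivable1_diffP; exact: ex_derive.
rewrite (@continuous_FTC2 _ _ F)//.
- by rewrite -EFinB /F mulrBl.
- by apply: continuous_subspaceT => y; exact: exprn_continuous.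
- split.
  + by move=> y _; exact: ex_derive.
  + by apply: cvg_at_right_filter; exact: cF.
  + by apply: cvg_at_left_filter; exact: cF.
- by move=> y _; rewrite derive1E derive_val.
Qed.

Lemma integral_id_sym w : 0 < w ->
  (\int[lebesgue_measure]_(s in `[(- (w / 2))%R, (w / 2)%R]) s%:E = 0)%E.
Proof.
move=> w0; rewrite (integral_exprn 1); last lra.
by congr (_%:E); field.
Qed.

Lemma integral_sqr_sym w : 0 < w ->
  (\int[lebesgue_measure]_(s in `[(- (w / 2))%R, (w / 2)%R]) (s ^+ 2)%:E =
   (w ^+ 3 / 12)%:E)%E.
Proof.
move=> w0; rewrite integral_exprn; last lra.
by congr (_%:E); field.
Qed.

End step_law.
(** * Moments and tail of the truncated steps *)

Section truncated_moments.
Context (R : realType) (d : measure_display) (T : measurableType d)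
  (P : probability T R).
Implicit Types h w : R.

Lemma integral_mscale (d' : measure_display) (S : measurableType d')
    (m : {measure set S -> \bar R}) (D : set S) (k : {nonneg R})
    (f : S -> \bar R) : measurable D -> m.-integrable D f ->
  (\int[mscale k m]_(s in D) f s = k%:num%:E * \int[m]_(s in D) f s)%E.
Proof.
move=> mD intf; have mf := measurable_int _ intf.
rewrite [LHS]integralE ge0_integral_mscale//; last exact: measurable_funepos.
rewrite ge0_integral_mscale//; last exact: measurable_funeneg.
rewrite -muleBr// -?integralE//.
by rewrite fin_num_adde_defr// integrable_pos_fin_num.
Qed.

(** The exponent is positive so that the truncated variable contributes nothing
    outside the interval, where the law carries atoms. *)
Lemma expectation_trunc_exprn h w (X : {RV P >-> R}) (n : nat) :
  0 < h -> 0 < w -> w <= 1 -> 1 <= x_ h w -> has_law P X (mu_ h w) ->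
  ('E_P[fun t => (trunc w (X t) ^+ n.+1)%R] =
   h%:E * \int[lebesgue_measure]_(s in `[(- (w / 2))%R, (w / 2)%R])
             (s ^+ n.+1)%:E)%E.
Proof.
move=> h0 w0 w1 x1 lawX.
have mf : measurable_fun setT (fun s => trunc w s ^+ n.+1).
  by apply: measurable_funX; exact: measurable_trunc.
(* Lebesgue measure lives on the copy of the real line generated by half-open
   intervals; the law of X is carried there so that both can be compared. *)
have mX : measurable_fun setT (X : T -> measurableTypeR R).
  exact: (measurable_funPT X).
pose Y : {RV P >-> measurableTypeR R} :=
  @mfun_Sub _ _ T (measurableTypeR R) X (mem_set mX).
transitivity (\int[distribution P Y]_s (trunc w s ^+ n.+1)%:E)%E.
  rewrite (@integral_distribution _ _ _ _ _ P Y (fun s => (trunc w s ^+ n.+1)%:E)).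
  - by rewrite unlock.
  - by apply/measurable_EFinP; exact: mf.
  - apply: (@bounded_integrable _ _ _ _ _ (w ^+ n.+1)).
      by apply: measurableT_comp mf _; exact: measurable_funPT.
    by move=> t; rewrite normrX lerXn2r ?nnegrE ?trunc_bounded// ltW.
transitivity (\int[distribution P Y]_(s in `[(- (w / 2))%R, (w / 2)%R])
    (s ^+ n.+1)%:E)%E.
  rewrite [RHS]integral_mkcond; apply: eq_integral => s _.
  rewrite patchE; case: ifPn; first by rewrite inE => /trunc_in->.
  by rewrite notin_setE => /trunc_out->; rewrite expr0n.
have h0' := ltW h0.
rewrite [LHS](@eq_measure_integral _ _ _ _
  (mscale (NngNum h0') lebesgue_measure)).
  rewrite integral_mscale//.
  apply: continuous_compact_integrable; first exact: segment_compact.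
  by apply: continuous_subspaceT => y; exact: exprn_continuous.
move=> A mA AD.
exact: etrans (lawX A mA) (mu_core h0 w1 x1 mA AD).
Qed.

Lemma trunc_mean0 h w (X : {RV P >-> R}) :
  0 < h -> 0 < w -> w <= 1 -> 1 <= x_ h w -> has_law P X (mu_ h w) ->
  ('E_P[trunc w \o X] = 0)%E.
Proof.
move=> h0 w0 w1 x1 lawX.
rewrite (_ : trunc w \o X = fun t => trunc w (X t) ^+ 1)//.
by rewrite (expectation_trunc_exprn 0 h0)// integral_id_sym// mule0.
Qed.

Lemma trunc_second_moment h w (X : {RV P >-> R}) :
  0 < h -> 0 < w -> w <= 1 -> 1 <= x_ h w -> has_law P X (mu_ h w) ->
  ('E_P[fun t => (trunc w (X t) ^+ 2)%R] = (h * w ^+ 3 / 12)%:E)%E.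
Proof.
move=> h0 w0 w1 x1 lawX.
by rewrite (expectation_trunc_exprn 1 h0)// integral_sqr_sym// -EFinM mulrA.
Qed.

(** Chebyshev's inequality for the sum of the truncated steps, whose mean is
    zero. *)
Lemma trunc_sum_tail h w (N : nat) (X : 'I_N -> {RV P >-> R}) (eps : R) :
  0 < h -> 0 < w -> w <= 1 -> 1 <= x_ h w ->
  mutually_independent P X -> (forall i, has_law P (X i) (mu_ h w)) ->
  0 < eps ->
  ((eps ^+ 2)%:E * P [set t | (eps <= `|\sum_i trunc w (X i t)|)%R] <=
   (N%:R * (h * w ^+ 3 / 12))%:E)%E.
Proof.
move=> h0 w0 w1 x1 ind law eps0.
have mS : measurable_fun setT (fun t => \sum_i trunc w (X i t)).
  apply: measurable_sum => i.
  by apply: measurableT_comp; [exact: measurable_trunc|exact: measurable_funPT].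
pose S : {RV P >-> R} := mfun_Sub (mem_set mS).
rewrite (_ : [set t | _] = [set t | eps%:E <= `|(S t)%:E|]%E); last first.
  by apply/seteqP; split => t /=; rewrite lee_fin.
apply: le_trans (@markov _ _ _ P S (fun r => r ^+ 2) _ eps0 _ _ _) _.
- exact: measurable_funX.
- by move=> r _; exact: sqr_ge0.
- by move=> r s; rewrite !nnegrE => r0 s0 rs; rewrite lerXn2r.
rewrite (_ : _ \o S = fun t => (\sum_i trunc w (X i t)) ^+ 2); last first.
  by apply/funext => t /=; rewrite real_normK// num_real.
rewrite (expectation_sqr_sum (c := w) (v := (h * w ^+ 3 / 12)%:E))//.
- by rewrite sumEFin sumr_const card_ord mulr_natl.
- exact: measurable_trunc.
- by move=> s; rewrite trunc_bounded// ltW.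
- by move=> i; rewrite (trunc_mean0 h0).
- by move=> i; rewrite (trunc_second_moment h0).
Qed.
End truncated_moments.
(** * Gaussian mass of an interval *)

Section gaussian_density.
Context (R : realType).

(** The tangent to exp (- t) at t = 1/2 gives a bound affine in a^2, and t = a^2/2
    runs over [1/2, 1] in the application; the constants come from 2 pi < 8,
    hence 1 / sqrt (2 pi) >= 35/100, and from exp (- 1/2) >= (7/8)^4 >= 58/100. *)
Lemma normal_pdf_ge (a s : R) : a ^+ 2 <= 3 -> `|s| <= a ->
  (3 - a ^+ 2) / 10 <= normal_pdf 0 1 s.
Proof.
move=> a3 sa.
have s2a2 : s ^+ 2 <= a ^+ 2.
  by rewrite -(real_normK (num_real s)) lerXn2r ?nnegrE// (le_trans _ sa).
rewrite normal_pdfE ?oner_neq0//.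
have peak_ge : 35 / 100 <= normal_peak (1 : R).
  rewrite /normal_peak expr1n mul1r -[35 / 100]invf_div lef_pV2 ?posrE//; last first.
    by rewrite sqrtr_gt0 mulrn_wgt0// pi_gt0.
  rewrite -[leRHS]ger0_norm// -sqrtr_sqr ler_sqrt//.
  have -> : (100 / 35) ^+ 2 = 400 / 49 :> R by field.
  suff : pi + pi <= 400 / 49 :> R by rewrite mulr2n.
  by have := @pihalf_lt2 R; lra.
have exp_half : 58 / 100 <= expR (- 2^-1 : R).
  rewrite (_ : - 2^-1 = 4%:R * (- 8^-1) :> R); last by field.
  have e8 : 7 / 8 <= expR (- 8^-1 : R).
    by apply: le_trans (expR_ge1Dx _); lra.
  rewrite expRM_natl.
  apply: (@le_trans _ _ ((7 / 8) ^+ 4)); first lra.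
  by rewrite lerXn2r ?nnegrE ?expR_ge0//; lra.
have fun_ge : 29 / 100 * (3 - a ^+ 2) <= normal_fun 0 1 s.
  rewrite /normal_fun subr0 expr1n.
  rewrite (_ : - s ^+ 2 / (1 *+ 2) = - 2^-1 + (2^-1 - s ^+ 2 / 2)); last by field.
  rewrite expRD.
  apply: (@le_trans _ _ (58 / 100 * (1 + (2^-1 - s ^+ 2 / 2)))); first lra.
  have := expR_ge1Dx (2^-1 - s ^+ 2 / 2).
  by move=> e; rewrite ler_pM//; lra.
apply: (@le_trans _ _ (35 / 100 * (29 / 100 * (3 - a ^+ 2)))); first lra.
by rewrite ler_pM//; lra.
Qed.

Lemma normal_prob_itv_ge (a l r : R) : a ^+ 2 <= 3 ->
  - a <= l -> l <= r -> r <= a ->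
  (((3 - a ^+ 2) / 10 * (r - l))%:E <= normal_prob 0 1 `]l, r])%E.
Proof.
move=> a3 al lr ra.
have -> : (((3 - a ^+ 2) / 10 * (r - l))%:E =
    \int[lebesgue_measure]_(s in `]l, r]) cst ((3 - a ^+ 2) / 10)%:E s)%E.
  rewrite integral_cst//= lebesgue_measure_itv/= lte_fin.
  move: lr; rewrite le_eqVlt => /predU1P[->|lr].
    by rewrite ltxx subrr mulr0 mule0.
  by rewrite lr EFinM EFinB.
apply: ge0_le_integral => //.
- by move=> s _; rewrite lee_fin; lra.
- apply/measurable_funTS/measurable_EFinP; exact: measurable_normal_pdf.
- move=> s; rewrite /= in_itv/= => /andP[ls sr].
  by rewrite lee_fin normal_pdf_ge// ler_norml; lra.
Qed.

End gaussian_density.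

(** * The Kolmogorov-Smirnov distance controls intervals *)

Section ks_distance.
Context (R : realType) (d d' : measure_display) (T : measurableType d)
  (T' : measurableType d') (P : probability T R) (Q : probability T' R).

Lemma cdf_itv (d0 : measure_display) (S : measurableType d0)
    (M : probability S R) (Y : {RV M >-> R}) (l r : R) : l <= r ->
  fine (cdf Y r) - fine (cdf Y l) = fine (distribution M Y `]l, r]).
Proof.
move=> lr; rewrite /cdf (@itv_bndbnd_setU _ _ -oo%O (BRight l) (BRight r))//.
rewrite measureU//=; last first.
  apply/seteqP; split => // s [] /=; rewrite !in_itv/=; lra.
by rewrite fineD ?fin_num_measure//; lra.
Qed.

Lemma le_dKS (Y : {RV P >-> R}) (Z : {RV Q >-> R}) (s : R) :
  `|fine (cdf Y s) - fine (cdf Z s)| <= dKS P Q Y Z.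
Proof.
apply: ub_le_sup; last by exists s.
exists 1 => _ [t _ <-].
have cdf01 (d0 : measure_display) (S : measurableType d0)
    (M : probability S R) (W : {RV M >-> R}) : 0 <= fine (cdf W t) <= 1.
  rewrite fine_ge0//=.
  rewrite -[leRHS]/(fine 1%:E) fine_le ?fin_num_measure//.
  exact: cdf_le1.
have := cdf01 _ _ _ Y; have := cdf01 _ _ _ Z; rewrite ler_norml; lra.
Qed.

Lemma dKS_itv (Y : {RV P >-> R}) (Z : {RV Q >-> R}) (l r : R) : l <= r ->
  fine (distribution Q Z `]l, r]) - fine (distribution P Y `]l, r]) <=
  2 * dKS P Q Y Z.
Proof.
move=> lr; rewrite -!cdf_itv//.
have := le_dKS Y Z r; have := le_dKS Y Z l; rewrite !ler_norml; lra.
Qed.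

End ks_distance.
(** * The lattice and its gaps *)

Section lattice_gaps.
Context (R : realType).

(** Up to its left endpoint, the set of points between z g and (z + 1) g at
    distance at least g/4 from the lattice g Z.  The interval is half-open so that its probability is a difference of
    distribution functions. *)
Definition gap (g : R) (z : int) : set R :=
  `](z%:~R + 1 / 4) * g, (z%:~R + 3 / 4) * g]%classic.

Lemma gap_far (x u : R) (n z : int) : 0 < x ->
  gap x z (n%:~R * x + u) -> x / 4 <= `|u|.
Proof.
move=> x0; rewrite /gap/= in_itv/= => /andP[lo hi].
have [nz|zn] := leP n z.
  have : n%:~R * x <= z%:~R * x by rewrite ler_pM2r// ler_int.
  by move=> ?; rewrite ler_normr; apply/orP; left; lra.
have : (z + 1)%:~R * x <= n%:~R * x by rewrite ler_pM2r// ler_int lezD1.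
rewrite intrD => ?; rewrite ler_normr; apply/orP; right; lra.
Qed.

Lemma trivIset_gap (g : R) (m : nat) : 0 < g ->
  trivIset setT (fun k : nat => gap g (k%:Z - m%:Z)).
Proof.
move=> g0.
suff lt_disj (i j : nat) (s : R) : gap g (i%:Z - m%:Z) s ->
    gap g (j%:Z - m%:Z) s -> (j <= i)%N.
  apply/trivIsetP => i j _ _ ij; apply/seteqP; split => // s [si sj].
  by move/eqP: ij; apply; apply/eqP; rewrite eqn_leq !(lt_disj _ _ s).
rewrite /gap/= !in_itv/= => /andP[_ hi] /andP[lo _].
rewrite leqNgt; apply/negP => ij.
have : ((i%:Z - m%:Z) + 1)%:~R * g <= (j%:Z - m%:Z)%:~R * g :> R.
  by rewrite ler_pM2r// ler_int; lia.
rewrite intrD; lra.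
Qed.

(** A step at an atom moves along the lattice and is truncated to 0; a step in
    the central interval leaves the lattice point alone and is its own
    truncation. *)
Lemma lattice_decomposition (h w : R) (I : finType) (y : I -> R) :
  0 < w -> w <= 1 -> 1 <= x_ h w ->
  (forall i, (`[- (w / 2), w / 2] `|` [set x_ h w; - x_ h w])%classic (y i)) ->
  exists n : int,
    \sum_i y i = n%:~R * x_ h w + \sum_i trunc w (y i).
Proof.
move=> w0 w1 x1 yP.
pose K (a b : R) := exists n : int, a = n%:~R * x_ h w + b.
suff : K (\sum_i y i) (\sum_i trunc w (y i)) by [].
apply: big_rec2; first by exists 0; rewrite mul0r add0r.
move=> i a b _ [n nE].
suff [k kE] : K (y i) (trunc w (y i)).
  by exists (k + n); rewrite nE {1}kE intrD; ring.
case: (yP i) => [yD|[]/= ->].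
- by exists 0; rewrite trunc_in// mul0r add0r.
- by exists 1; rewrite trunc_out ?mul1r ?addr0//= in_itv/=; lra.
- by exists (-1); rewrite trunc_out ?mulN1r ?addr0//= in_itv/=; lra.
Qed.

End lattice_gaps.

Section gap_probability.
Context (R : realType) (d : measure_display) (T : measurableType d)
  (P : probability T R).

(** The gaps are disjoint, so the left-hand side is the probability of their
    union; outside the null event that some step misses the support of its
    law, being in a gap forces the truncated steps to add up to x/4 or more in
    absolute value. *)
Lemma normalized_sum_gaps (h w : R) (N m n : nat) (X : 'I_N -> {RV P >-> R}) :
  0 < h -> 0 < w -> w <= 1 -> 1 <= x_ h w -> (1 <= N)%N ->
  mutually_independent P X -> (forall i, has_law P (X i) (mu_ h w)) ->
  (\sum_(k < n) distribution P (normalized_sum X)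
      (gap (x_ h w / Num.sqrt N%:R) (k%:Z - m%:Z)) <=
   P [set t | (x_ h w / 4 <= `|\sum_i trunc w (X i t)|)%R])%E.
Proof.
move=> h0 w0 w1 x1 N1 ind law.
set x := x_ h w in x1 *.
have x0 : 0 < x by lra.
have sN0 : 0 < Num.sqrt N%:R :> R by rewrite sqrtr_gt0 ltr0n.
set g := x / Num.sqrt N%:R.
have g0 : 0 < g by rewrite divr_gt0.
pose A := \big[setU/set0]_(k < n) gap g (k%:Z - m%:Z).
have mgap z : measurable (gap g z) by exact: measurable_itv.
rewrite -(measure_bigsetU _ (fun k => mgap (k%:Z - m%:Z)) (trivIset_gap (m := m) g0)).
set B := [set t | _].
have mA : measurable (normalized_sum X @^-1` A).
  by apply: measurable_funPTI; exact: bigsetU_measurable.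
have mS : measurable_fun setT (fun t => \sum_i trunc w (X i t)).
  apply: measurable_sum => i.
  by apply: measurableT_comp; [exact: measurable_trunc|exact: measurable_funPT].
have mB : measurable B.
  rewrite (_ : B = (fun t => `|\sum_i trunc w (X i t)|) @^-1` `[x / 4, +oo[).
    rewrite -[X in measurable X]setTI.
    by apply: measurableT_comp => //; exact: measurable_itv.
  by apply/seteqP; split => t /=; rewrite in_itv/= andbT.
have [C [mC C0 BC]] : {ae P, forall t, (normalized_sum X @^-1` A) t -> B t}.
  have : {ae P, forall t, forall i,
      (`[- (w / 2), w / 2] `|` [set x_ h w; - x_ h w])%classic (X i t)}.
    apply: filter_forall => i.
    have mU : measurable (~` (`[- (w / 2), w / 2] `|` [set x_ h w; - x_ h w])).
      by apply: measurableC; apply: measurableU => //; exact: measurableU.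
    exists (X i @^-1` (~` (`[- (w / 2), w / 2] `|` [set x_ h w; - x_ h w]))).
    split => //; first exact: measurable_funPTI.
    by rewrite -[LHS]/(distribution P (X i) _) law// mu_support.
  apply: filterS => t tD.
  rewrite /A -(bigcup_mkord n (fun k => gap g (k%:Z - m%:Z))) => -[k _].
  have [z zE] := lattice_decomposition w0 w1 x1 tD.
  rewrite /gap/= in_itv/= /normalized_sum zE => /andP[lo hi].
  apply: (@gap_far _ x _ z (k%:Z - m%:Z)) => //.
  rewrite /gap/= in_itv/=; apply/andP; split.
    by move: lo; rewrite /g [_ * (x / _)]mulrA ltr_pM2r ?invr_gt0.
  by move: hi; rewrite /g [_ * (x / _)]mulrA ler_pM2r ?invr_gt0.
rewrite -[leRHS]adde0 -C0; apply: le_trans (measureU2 _ mB mC).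
apply: (@le_measure _ _ _ P); rewrite ?inE//; first exact: measurableU.
move=> t At; have [Bt|nBt] := pselect (B t); first by left.
by right; apply: BC => /(_ At).
Qed.
End gap_probability.
(** * The numerical inequality *)

(** In units of 1 / sqrt N, the first term is the contribution of the Gaussian
    mass of the gaps, the second that of the truncated steps reaching x/4.  The
    chord 6/10 + 4/10 x^2 <= x on [1, 3/2] turns the claim into a polynomial
    inequality in y = x^2 on [1, 2], which follows from (y - 1)(2 - y) >= 0 and
    its product with y. *)
Lemma gap_tradeoff_ge (R : realType) (x : R) : 1 <= x -> x ^+ 2 <= 2 ->
  1 / 50 <= x * (3 - x ^+ 2) / 40 - 1 / (36 * x ^+ 2).
Proof.
move=> x1 x2; have x32 : x <= 3 / 2.
  by rewrite -(@ler_sqr R) ?nnegrE; lra.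
have chord : 6 / 10 + 4 / 10 * x ^+ 2 <= x.
  have : 0 <= (x - 1) * (3 / 2 - x) by rewrite mulr_ge0; lra.
  lra.
have : 1 <= x ^+ 2 by exact: exprn_ege1.
move: (x ^+ 2) x2 chord => y y2 chord y1.
rewrite lerBrDr -lerBrDl.
rewrite ler_pdivrMr; last lra.
apply: (@le_trans _ _
  (((6 / 10 + 4 / 10 * y) * (3 - y) / 40 - 1 / 50) * (36 * y))); last first.
  rewrite ler_wpM2r ?lerB// ?ler_wpM2r//; lra.
have q0 : 0 <= (y - 1) * (2 - y) by rewrite mulr_ge0; lra.
have : 0 <= y * ((y - 1) * (2 - y)) by rewrite mulr_ge0; lra.
lra.
Qed.

(** * The lower bound *)

Theorem lemma5p1 (R : realType) (h w : R) (N : nat)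
    (d d' : measure_display) (T : measurableType d) (T' : measurableType d')
    (P : probability T R) (Q : probability T' R)
    (X : 'I_N -> {RV P >-> R}) (G : {RV Q >-> R}) :
  0 < h -> h <= 1 -> 0 < w -> w <= 1 ->
  h * w <= 1 / 2 ->
  (1 <= N)%N ->
  h * w ^+ 3 * N%:R <= 1 / 24 ->
  mutually_independent P X ->
  (forall i : 'I_N, has_law P (X i) (mu_ h w)) ->
  has_law Q G (normal_prob 0 1) ->
  1 / 50 * (1 / Num.sqrt N%:R) <= dKS P Q (normalized_sum X) G.
Proof.
move=> h0 h1 w0 w1 hw N1 hwN ind law lawG.
have x1 := x_ge1 h0 w0 w1 hw.
have x2 := x_sqr_le2 h0 w0 hw.
pose r : R := Num.sqrt N%:R.
have r1 : 1 <= r by rewrite -sqrtr1 ler_sqrt ?ler0n// ler1n.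
pose m := Num.truncn r.
have /andP[mr rm] : m%:R <= r < m.+1%:R by apply: truncn_itv; lra.
have m1 : 1 <= m%:R :> R by rewrite ler1n truncn_gt0.
have tail := trunc_sum_tail h0 w0 w1 x1 ind law (eps := x_ h w / 4).
have gaps := normalized_sum_gaps m m.*2 h0 w0 w1 x1 N1 ind law.
move: x1 x2 tail gaps; set x := x_ h w => x1 x2 tail gaps.
pose g := x / r.
have g0 : 0 < g by rewrite divr_gt0; lra.
have gr : g * r = x by rewrite /g divfK//; lra.
pose p (k : nat) := distribution P (normalized_sum X) (gap g (k%:Z - m%:Z)).
set D := dKS _ _ _ _.
(* The m gaps on each side of 0 stay inside [-x, x] because m <= r, where the
   Gaussian density is at least (3 - x^2) / 10. *)
have gapD (k : 'I_m.*2) :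
    (3 - x ^+ 2) / 10 * (g / 2) - fine (p k) <= 2 * D.
  have lr : ((k%:Z - m%:Z)%:~R + 1 / 4) * g <= ((k%:Z - m%:Z)%:~R + 3 / 4) * g.
    by rewrite ler_pM2r//; lra.
  apply: le_trans (dKS_itv (normalized_sum X) G lr).
  rewrite lerB// lawG; last exact: measurable_itv.
  have mgx : m%:R * g <= x by rewrite -gr mulrC ler_pM2l.
  have kg0 : 0 <= k%:R * g by rewrite mulr_ge0 ?ler0n// ltW.
  have kgm : (k%:R + 1) * g <= 2 * m%:R * g.
    by rewrite ler_pM2r// natr1 -natrM ler_nat mul2n ltn_ord.
  rewrite -[leLHS]/(fine (_%:E)) fine_le ?fin_num_measure//.
  rewrite (_ : g / 2 = ((k%:Z - m%:Z)%:~R + 3 / 4) * g -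
                       ((k%:Z - m%:Z)%:~R + 1 / 4) * g); last by field.
  by rewrite intrB/= -!pmulrn; apply: normal_prob_itv_ge; lra.
have sum_le : m%:R * ((3 - x ^+ 2) / 10 * g) - \sum_(k < m.*2) fine (p k) <=
    4 * m%:R * D.
  have : \sum_(k < m.*2) ((3 - x ^+ 2) / 10 * (g / 2) - fine (p k)) <=
      \sum_(k < m.*2) (2 * D) by apply: ler_sum => k _; exact: gapD.
  have sumc (c : R) : \sum_(k < m.*2) c = 2 * m%:R * c.
    by rewrite sumr_const card_ord -[LHS]mulr_natl -mul2n natrM.
  rewrite big_split/= sumrN !sumc; lra.
(* Chebyshev with threshold x/4 and variance N h w^3 / 12 <= 1/288. *)
have p_le : x ^+ 2 * \sum_(k < m.*2) fine (p k) <= 1 / 18.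
  have {}tail := tail (ltac:(lra)).
  have {}gaps : ((\sum_(k < m.*2) fine (p k))%:E <=
      P [set t | (x / 4 <= `|\sum_i trunc w (X i t)|)%R])%E.
    rewrite -sumEFin; apply: le_trans gaps.
    by apply: lee_sum => k _; rewrite fineK// fin_num_measure//; exact: measurable_itv.
  have : (((x / 4) ^+ 2 * \sum_(k < m.*2) fine (p k))%:E <=
      (N%:R * (h * w ^+ 3 / 12))%:E)%E.
    by apply: le_trans tail; rewrite EFinM lee_pmul2l// lte_fin exprn_gt0//; lra.
  rewrite lee_fin; lra.
have trade := gap_tradeoff_ge x1 x2.
rewrite -/r mulrA mulr1 ler_pdivrMr; last lra.
move: sum_le p_le; set F := \sum_(k < _) _ => sum_le p_le.
have F0 : 0 <= F by apply: sumr_ge0 => k _; rewrite fine_ge0.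
(* Since m >= 1, r < m + 1 <= 2m: taking the integer part of sqrt N costs at
   most a factor 2. *)
have r2m : r <= 2 * m%:R by move: rm; rewrite -natr1; lra.
have F_le : F / 2 <= 1 / (36 * x ^+ 2).
  have x20 : 0 < x ^+ 2 by rewrite exprn_gt0//; lra.
  by rewrite ler_pdivlMr; lra.
suff : m%:R * (x * (3 - x ^+ 2) / 40 - F / 2) <= m%:R * (D * r).
  by rewrite ler_pM2l; lra.
have : (m%:R * ((3 - x ^+ 2) / 10 * g) - F) * r <= 4 * m%:R * D * r.
  by rewrite ler_pM2r//; lra.
have : F * r <= F * (2 * m%:R) by rewrite ler_wpM2l.
have -> : (m%:R * ((3 - x ^+ 2) / 10 * g) - F) * r =
    m%:R * ((3 - x ^+ 2) / 10 * x) - F * r by rewrite -gr; ring.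
lra.
Qed.
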